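(* Let $\alpha,\beta\in(0,1]$ and $n,d\in\mathbb{N}$. If $\mathsf{M}\colon\{-1,1\}^{n\times d}\to[-1,1]^d$ is an $(\alpha,\beta)$-weakly-accurate mechanism that is $\left(1,\frac{\beta}{4n}\right)$-differentially private, then $$n\geq \Omega\!\left(\frac{\sqrt{\alpha d}}{\log^{1.5}(\alpha d/\beta)}\right).$$
   Context: A matrix $X=(x_i^j)\in\{-1,1\}^{n\times d}$ is viewed as a dataset whose elements are its rows $x_1,\dots,x_n$. A (randomized) mechanism $\mathsf{M}$ on datasets is $(\varepsilon,\delta)$-differentially private if for every two datasets $X,X'$ differing in exactly one row and every set $T$ of outputs, $\Pr[\mathsf{M}(X)\in T]\le e^{\varepsilon}\Pr[\mathsf{M}(X')\in T]+\delta$. For $b\in\{-1,1\}$, a column $j\in[d]$ of $X$ is $b$-marked if $x_1^j=\dots=x_n^j=b$; $\mathcal{J}_X^b\subseteq[d]$ denotes the set of $b$-marked columns. A vector $q=(q^1,\dots,q^d)$ strongly-agrees with $X$ if for both $b\in\{-1,1\}$, $|\{j\in\mathcal{J}_X^b: q^j=b\}|\ge 0.9|\mathcal{J}_X^b|$. A mechanism $\mathsf{M}\colon\{-1,1\}^{n\times d}\to[-1,1]^d$ is $(\alpha,\beta)$-weakly-accurate if for every $X\in\{-1,1\}^{n\times d}$ with $|\mathcal{J}_X^1|,|\mathcal{J}_X^{-1}|\ge\frac12(1-\alpha)d$, the probability that $\mathsf{M}(X)$ strongly-agrees with $X$ is at least $\beta$. The $\Omega(\cdot)$ hides a positive absolute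 constant.
   Formalization: The logarithm log(αd/β) is replaced by max(1, log(αd/β)), since the bound with the bare logarithm is false or undefined when αd/β is close to or below 1 (for example d = 1, α = 1, β close to 1). *)

(* Defs.v *)
From HB Require Import structures.
From mathcomp Require Import all_boot all_order all_algebra.
From mathcomp Require Import all_classical all_reals all_analysis.
Set Implicit Arguments. Unset Strict Implicit. Unset Printing Implicit Defensive.
Import Order.TTheory GRing.Theory Num.Theory.
Local Open Scope ring_scope.
Local Open Scope classical_set_scope.


Definition pm1_dataset (R : realType) (n d : nat) (X : 'M[R]_(n, d)) : Prop :=
  forall i j, X i j = 1 \/ X i j = -1.

Definition neighbors (R : realType) (n d : nat) (X X' : 'M[R]_(n, d)) : Prop :=
  exists i : 'I_n, row i X != row i X' /\ forall k : 'I_n, k != i -> row k X = row k X'.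

(* Outputs live in d.-tuple R (product Borel sigma-algebra); a randomized
   mechanism maps each dataset to a probability distribution over outputs. *)
Definition mechanism (R : realType) (n d : nat) :=
  'M[R]_(n, d) -> probability (d.-tuple R) R.

Definition cube (R : realType) (d : nat) : set (d.-tuple R) :=
  [set q | forall j : 'I_d, -1 <= tnth q j <= 1].

(* M : {-1,1}^{n x d} -> [-1,1]^d : on every dataset the output lies in the cube a.s. *)
Definition cube_valued (R : realType) (n d : nat) (M : mechanism R n d) : Prop :=
  forall X, pm1_dataset X -> M X (@cube R d) = 1%E.

Definition differentially_private (R : realType) (n d : nat) (M : mechanism R n d) (eps delta : R) : Prop :=
  forall X X', pm1_dataset X -> pm1_dataset X' -> neighbors X X' ->
    forall T : set (d.-tuple R), measurable T ->
      (M X T <= (expR eps)%:E * M X' T + delta%:E)%E.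

Definition marked (R : realType) (n d : nat) (X : 'M[R]_(n, d)) (b : R) : {set 'I_d} :=
  [set j : 'I_d | [forall i : 'I_n, X i j == b]].

Definition strongly_agrees (R : realType) (n d : nat) (X : 'M[R]_(n, d)) (q : d.-tuple R) : Prop :=
  forall b : R, (b = 1 \/ b = -1) ->
    (#|[set j in marked X b | tnth q j == b]|%:R : R) >= (9 / 10) * #|marked X b|%:R.

Definition weakly_accurate (R : realType) (n d : nat) (M : mechanism R n d) (alpha beta : R) : Prop :=
  forall X, pm1_dataset X ->
    (#|marked X 1|%:R : R) >= (1 - alpha) * d%:R / 2 ->
    (#|marked X (-1)|%:R : R) >= (1 - alpha) * d%:R / 2 ->
    (beta%:E <= M X [set q | strongly_agrees X q])%E.

(* Main.v *)
Require Import Defs.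
From HB Require Import structures.
From mathcomp Require Import all_boot all_order all_algebra all_fingroup.
From mathcomp Require Import all_classical all_reals all_analysis.
From mathcomp Require Import ring lra zify.
Import Order.TTheory GRing.Theory Num.Theory.
Local Open Scope ring_scope.
Set Implicit Arguments. Unset Strict Implicit. Unset Printing Implicit Defensive.

(** A padded-and-permuted fingerprinting code.  The [d] columns are cut into
    about [alpha d / 3] independent blocks, each consisting of one code column
    and [B] pads of either sign, in a uniformly random order.  A code column has
    [n + 1] bits: one per row of the dataset and one for a ghost row that the
    mechanism does not see.  A column with [k] ones has a weight depending on
    [k] only, chosen so that, given the [n] visible bits and unless they are all
    equal, the centred ghost bit [g - k / (n + 1)] has mean zero.  If the visible
    bits are all equal, the column looks like a pad, and the small bias of the
    ghost bit is opposite to the sign of the column.  Score every row by the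
    correlation of the answer with its centred code bits.  An answer agreeing
    with the marked columns pushes the ghost score below zero, except with
    probability exponentially small in [alpha d / (n log n)^2]; as the scores
    add up to zero, some real row then has a nonnegative score.  Exchanging that
    row with the ghost changes one row of the dataset and leaves the joint law
    unchanged, so privacy bounds the probability of a nonnegative score of a real
    row by that of the ghost. *)

(** * Concentration conditionally on the observed blocks *)

(** [expR x] is at most [1 / (1 - x)], while [(1 - x) (1 + x + 2 x^2) = 1 + x^2 (1 - 2 x)] is at
    least one. *)
Lemma expR_le_quad (R : realType) (x : R) : x <= 1 / 2 -> expR x <= 1 + x + 2 * x ^+ 2.
Proof.
move=> hx; have h1 : 0 < 1 - x by lra.
have h2 : 1 - x <= expR (- x) by apply: expR_ge1Dx.
have h3 : expR x * (1 - x) <= 1.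
  by apply: le_trans (_ : expR x * expR (- x) <= 1); rewrite ?ler_pM2l ?expR_gt0 // expRxMexpNx_1.
rewrite -(ler_pM2r h1); apply: (le_trans h3).
have : 0 <= x ^+ 2 * (1 - 2 * x) by apply: mulr_ge0; [exact: sqr_ge0|lra].
by rewrite !exprS expr0; lra.
Qed.

Section Concentration.
Variables (R : realType) (I H Y : finType) (D : H -> Y) (mu : H -> R).
Hypothesis mu_ge0 : forall h, 0 <= mu h.

(** [Q] is constant on each fibre of the observation map, and the rest of the sum over that fibre
    factors over the coordinates. *)
Lemma sum_fibers_prod_le (Q : {ffun I -> Y} -> R) (e : I -> H -> R) (rho : R) :
  (forall y, 0 <= Q y) -> (forall i h, 0 <= e i h) ->
  (forall i y, \sum_(h | D h == y) mu h * e i h <= rho * \sum_(h | D h == y) mu h) ->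
  \sum_(h : {ffun I -> H}) (\prod_i mu (h i)) * Q [ffun i => D (h i)] * \prod_i e i (h i)
  <= rho ^+ #|I| * \sum_(h : {ffun I -> H}) (\prod_i mu (h i)) * Q [ffun i => D (h i)].
Proof.
move=> Q0 e0 he.
pose obs (h : {ffun I -> H}) := [ffun i => D (h i)].
have obsE y h : (obs h == y) = (h \in family (fun i => [pred a | D a == y i])).
  apply/eqP/familyP => [<- i|hy]; first by rewrite inE ffunE.
  by apply/ffunP => i; rewrite ffunE; have := hy i; rewrite inE => /eqP.
rewrite (partition_big obs predT) //= [X in _ <= _ * X](partition_big obs predT) //=.
rewrite mulr_sumr; apply: ler_sum => y _.
have -> : \sum_(h | obs h == y) (\prod_i mu (h i)) * Q [ffun i => D (h i)] * \prod_i e i (h i)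
   = Q y * \prod_i \sum_(h | D h == y i) mu h * e i h.
  rewrite bigA_distr_big_dep mulr_sumr; apply: eq_big => [h|h /eqP <-]; first exact: obsE.
  by rewrite big_split /= -/(obs h); ring.
have -> : \sum_(h | obs h == y) (\prod_i mu (h i)) * Q [ffun i => D (h i)]
   = Q y * \prod_i \sum_(h | D h == y i) mu h.
  rewrite bigA_distr_big_dep mulr_sumr; apply: eq_big => [h|h /eqP <-]; first exact: obsE.
  by rewrite mulrC.
rewrite mulrCA ler_wpM2l // -prodr_const -big_split /=.
apply: ler_prod => i _; apply/andP; split; last exact: he.
by apply: sumr_ge0 => h _; apply: mulr_ge0.
Qed.

(** An exponential Markov bound with parameter [c / 16]. The last hypothesis says that [w i] has
    conditional mean at most [- c]; it is left unnormalized so that null fibres need no separate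
    treatment. *)
Lemma conditional_chernoff (Q : {ffun I -> Y} -> R) (w : I -> H -> R) (c : R) :
  (forall y, 0 <= Q y) -> 0 <= c <= 1 -> (forall i h, `|w i h| <= 2) ->
  (forall i y, \sum_(h | D h == y) mu h * (w i h + c) <= 0) ->
  \sum_(h : {ffun I -> H} | 0 <= \sum_i w i (h i)) (\prod_i mu (h i)) * Q [ffun i => D (h i)]
  <= expR (- (#|I|%:R * c ^+ 2 / 32))
     * \sum_(h : {ffun I -> H}) (\prod_i mu (h i)) * Q [ffun i => D (h i)].
Proof.
move=> Q0 /andP[c0 c1] w2 hw.
have -> : expR (- (#|I|%:R * c ^+ 2 / 32)) = expR (- (c ^+ 2 / 32)) ^+ #|I|.
  by rewrite -expRM_natl; congr expR; field.
have hP (h : {ffun I -> H}) : 0 <= (\prod_i mu (h i)) * Q [ffun i => D (h i)].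
  by apply: mulr_ge0 => //; apply: prodr_ge0.
apply: le_trans (sum_fibers_prod_le (e := fun i h => expR (c / 16 * w i h)) _ _ _) => //;
  last 1 first.
- move=> i y; have q0 := hw i y; rewrite mulr_sumr.
  apply: (@le_trans _ _ (\sum_(h | D h == y) mu h * (1 + c / 16 * w i h + c ^+ 2 / 32))).
    apply: ler_sum => h _; apply: ler_wpM2l => //.
    have := w2 i h; rewrite ler_norml => /andP[l1 l2].
    have hq : c / 16 * w i h <= 1 / 2 by nra.
    apply: (le_trans (expR_le_quad hq)); rewrite lerD2l exprMn.
    have : w i h ^+ 2 <= 4 by rewrite expr2; nra.
    have : 0 <= c ^+ 2 by exact: sqr_ge0.
    by rewrite expr_div_n; nra.
  (* The conditional mean contributes at most [- c^2 / 16], the quadratic term [c^2 / 32]. *)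
  apply: (@le_trans _ _ (\sum_(h | D h == y) (1 - c ^+ 2 / 32) * mu h)).
    have -> : \sum_(h | D h == y) mu h * (1 + c / 16 * w i h + c ^+ 2 / 32)
      = c / 16 * (\sum_(h | D h == y) mu h * (w i h + c))
        + \sum_(h | D h == y) (1 - c ^+ 2 / 32) * mu h.
      by rewrite mulr_sumr -big_split /=; apply: eq_bigr => h _; field.
    by rewrite gerDr; nra.
  apply: ler_sum => h _; apply: ler_wpM2r => //.
  exact: expR_ge1Dx.
- rewrite big_mkcond /=; apply: ler_sum => h _.
case: ifP => hs; last by apply: mulr_ge0 => //; apply: prodr_ge0 => i _; exact: expR_ge0.
rewrite ler_peMr // -expR_sum -mulr_sumr -expR0 ler_expR.
by apply: mulr_ge0 => //; apply: divr_ge0.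
Qed.

End Concentration.

(** * The code *)

Lemma big_option (V : Type) (idx : V) (op : Monoid.com_law idx) (T : finType)
    (f : option T -> V) :
  \big[op/idx]_o f o = op (f None) (\big[op/idx]_i f (Some i)).
Proof.
rewrite (bigD1 None) //=; congr (op _ _).
rewrite (reindex_omap Some id) /=; last by case.
by apply: eq_bigl => i; rewrite eqxx.
Qed.

(* [None] is the code column, [Some (b, i)] the [i]-th pad of sign [b]. *)
Local Notation slot B := (option (bool * 'I_B)).

(* The slot at each position of a block, the ghost bit, and the set of rows
   whose bit in the code column is one. *)
Local Notation state n B := ({perm slot B} * (bool * {set 'I_n}))%type.

Section Code.
Variables (R : realType) (n B : nat) (A : R).

Implicit Types (h : state n B) (x : {set 'I_n}) (s : {perm slot B})
  (v : {ffun slot B -> bool}) (t : slot B) (o : option 'I_n).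

Definition slot_column x t : {set 'I_n} :=
  if t is Some (b, _) then (if b then finset.setT else finset.set0) else x.

Definition block h : {ffun slot B -> {set 'I_n}} :=
  [ffun j => slot_column h.2.2 (h.1 j)].

Definition ones h : nat := (h.2.1 + #|h.2.2|)%N.

(* [binomial_weight] and [column_weight_step] are the two properties that dictate
   this choice; [A] controls how often the code column imitates a pad. *)
Definition column_weight k : R :=
  if (k == 0)%N || (k == n.+1)%N then A else (k.-1)`!%:R * (n - k)`!%:R / n`!%:R.

Definition weight h : R := column_weight (ones h).

Definition bit o h : bool := if o is Some i then i \in h.2.2 else h.2.1.

Definition spin v s t : R := if v ((s^-1)%g t) then 1 else -1.

Definition score v o h : R :=
  spin v h.1 None * ((bit o h)%:R - (ones h)%:R / n.+1%:R).

Definition mean_spin v s b : R :=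
  (spin v s None + \sum_(i < B) spin v s (Some (b, i))) / B.+1%:R.

(** Oriented so that it is near one if the answer respects a marked code column. It averages over
    the pads of the same sign because a block does not tell them from that column. *)
Definition agreement v h : R :=
  if ones h == n.+1 then mean_spin v h.1 true
  else if ones h == 0%N then - mean_spin v h.1 false else 0.

Definition constant_state h : bool := (ones h == 0%N) || (ones h == n.+1).

Lemma ones_le h : (ones h <= n.+1)%N.
Proof. by rewrite /ones; have := subset_leq_card (finset.subsetT h.2.2); rewrite cardsT card_ord; case: h.2.1 => /=; lia. Qed.

Lemma normr_spin v s t : `|spin v s t| = 1.
Proof. by rewrite /spin; case: ifP; rewrite ?normrN1 ?normr1. Qed.

Lemma normr_score v o h : `|score v o h| <= 1.
Proof.
rewrite /score normrM normr_spin mul1r.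
have h0 : (0 : R) < n.+1%:R by rewrite ltr0n.
have h1 : 0 <= (ones h)%:R / n.+1%:R :> R by rewrite divr_ge0.
have h2 : (ones h)%:R / n.+1%:R <= 1 :> R by rewrite ler_pdivrMr // mul1r ler_nat ones_le.
by move: (_ / _) h1 h2 => z h1 h2; rewrite ler_norml; case: (bit o h) => /=; lra.
Qed.

Lemma normr_mean_spin v s b : `|mean_spin v s b| <= 1.
Proof.
rewrite /mean_spin normrM normfV [`|B.+1%:R|]ger0_norm // ler_pdivrMr ?ltr0n // mul1r.
apply: (le_trans (ler_normD _ _)); rewrite normr_spin -natr1 addrC lerD2r.
apply: (le_trans (ler_norm_sum _ _ _)).
by under eq_bigr do rewrite normr_spin; rewrite sumr_const card_ord.
Qed.

Lemma normr_agreement v h : `|agreement v h| <= 1.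
Proof.
rewrite /agreement; case: ifP => _; first exact: normr_mean_spin.
by case: ifP => _; rewrite ?normrN ?normr_mean_spin // normr0.
Qed.

Lemma sum_score v h : \sum_o score v o h = 0.
Proof.
rewrite /score -mulr_sumr sumrB sumr_const card_option card_ord.
have -> : \sum_o (bit o h)%:R = (ones h)%:R :> R.
  rewrite -natr_sum; congr (_%:R).
  by rewrite big_option /= /ones -sum1_card [in RHS]big_mkcond.
by rewrite -[_ / _ *+ _]mulr_natr divfK ?subrr ?mulr0 // pnatr_eq0.
Qed.

Lemma sum_states (F : {perm slot B} -> bool -> {set 'I_n} -> R) :
  \sum_(h : state n B) F h.1 h.2.1 h.2.2
  = \sum_x \sum_s (F s true x + F s false x).
Proof.
rewrite exchange_big /=.
rewrite -(pair_bigA _ (fun s gx => F s gx.1 gx.2)) /=; apply: eq_bigr => s _.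
rewrite -(pair_bigA _ (fun g x => F s g x)) /= exchange_big /=; apply: eq_bigr => x _.
by rewrite big_bool.
Qed.

(* A pad carries the same column as a marked code column, so transposing the two
   slots preserves the block. *)
Lemma sum_spin_pad v (y : {ffun slot B -> {set 'I_n}}) b (i : 'I_B) :
  let x := if b then finset.setT else finset.set0 in
  \sum_s (block (s, (b, x)) == y)%:R * spin v s (Some (b, i))
  = \sum_s (block (s, (b, x)) == y)%:R * spin v s None.
Proof.
move=> x; rewrite [RHS](reindex_inj (mulIg (tperm None (Some (b, i))))) /=.
apply: eq_bigr => s _; congr (_%:R * _).
  congr (_ == _); apply/ffunP => j; rewrite !ffunE permM /=.
  by case: tpermP => [-> | -> | _ _] //=.
by rewrite /spin invMg permM tpermV tpermL.
Qed.

(** Given the block, a marked code column is equally likely to sit at any of the [B.+1] places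
    showing its slot or a pad of its sign. *)
Lemma sum_mean_spin v (y : {ffun slot B -> {set 'I_n}}) b :
  let x := if b then finset.setT else finset.set0 in
  \sum_s (block (s, (b, x)) == y)%:R * mean_spin v s b
  = \sum_s (block (s, (b, x)) == y)%:R * spin v s None.
Proof.
move=> x; rewrite /mean_spin; under eq_bigr do rewrite mulrA mulrDr mulr_sumr.
rewrite -mulr_suml big_split /= exchange_big /=.
under [X in _ + X]eq_bigr do rewrite sum_spin_pad.
by rewrite sumr_const card_ord -mulrS -[_ *+ B.+1]mulr_natr mulfK // pnatr_eq0.
Qed.

Hypotheses (n_gt0 : (0 < n)%N) (A_gt0 : 0 < A).

Lemma weight_ge0 h : 0 <= weight h.
Proof.
by rewrite /weight /column_weight; case: ifP => _; [exact: ltW|rewrite divr_ge0 ?mulr_ge0].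
Qed.

Lemma column_weight1 : column_weight 1 = n%:R^-1.
Proof.
rewrite /column_weight /=; have -> : (1 == n.+1)%N = false by lia.
rewrite mul1r subn1 -(prednK n_gt0) factS natrM invfM mulrCA mulfV ?mulr1 //=.
Qed.

Lemma column_weightn : column_weight n = n%:R^-1.
Proof.
rewrite /column_weight; have -> : (n == 0)%N || (n == n.+1)%N = false by lia.
rewrite subnn mulr1 -(prednK n_gt0) factS natrM invfM mulrCA mulfV ?mulr1 //=.
Qed.

(** A balance equation: with [w] visible ones, the centred ghost bit is [(n - w) / (n + 1)] or
    [- w / (n + 1)], and the two weights make these values cancel. *)
Lemma column_weight_step w : (0 < w < n)%N ->
  column_weight w.+1 * (n - w)%:R = column_weight w * w%:R.
Proof.
move=> hw; rewrite /column_weight.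
have -> : (w.+1 == 0)%N || (w.+1 == n.+1)%N = false by lia.
have -> : (w == 0)%N || (w == n.+1)%N = false by lia.
have [w' ew] : exists w', w = w'.+1 by exists w.-1; lia.
rewrite ew in hw *.
have [r hr] : exists r, (n - w'.+1)%N = r.+1 by exists (n - w'.+2)%N; lia.
have -> : (n - w'.+2)%N = r by lia.
rewrite hr !factS /= !natrM; ring.
Qed.

(** The block does not depend on the ghost bit, so the two ghost bits are paired over each visible
    column. If that column is marked, one of the two states has all bits equal: its score is zero
    and its agreement term is [A / (n.+1 A)] times a mean spin, up to sign. The other has weight
    [1 / n] and a centred bit [n / n.+1] in absolute value. After summation over the permutations
    the two cancel, which fixes the factor of [agreement]. *)
Lemma conditional_mean v (y : {ffun slot B -> {set 'I_n}}) :
  \sum_(h : state n B | block h == y)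
    weight h * (score v None h + (n.+1%:R * A)^-1 * agreement v h) = 0.
Proof.
have n0 : n%:R != 0 :> R by rewrite pnatr_eq0 -lt0n.
have nS0 : n.+1%:R != 0 :> R by rewrite pnatr_eq0.
have A0 : A != 0 by rewrite gt_eqF.
pose F s g x : R := (block (s, (g, x)) == y)%:R * (weight (s, (g, x)) *
  (score v None (s, (g, x)) + (n.+1%:R * A)^-1 * agreement v (s, (g, x)))).
transitivity (\sum_(h : state n B) F h.1 h.2.1 h.2.2).
  rewrite big_mkcond; apply: eq_bigr => -[s [g x]] _ /=.
  by rewrite /F; case: ifP => _; rewrite ?mul1r ?mul0r.
rewrite sum_states; apply: big1 => x _.
have [->|x0] := eqVneq x finset.set0.
  have E s : F s true finset.set0 + F s false finset.set0
    = n.+1%:R^-1 * ((block (s, (false, finset.set0)) == y)%:R * spin v s None)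
      - n.+1%:R^-1 * ((block (s, (false, finset.set0)) == y)%:R * mean_spin v s false).
    rewrite /F /weight /score /agreement /ones /= cards0 addn0 /=.
    have -> : (1 == n.+1)%N = false by lia.
    rewrite column_weight1 /column_weight /=.
    rewrite -[block (s, (true, _))]/(block (s, (false, finset.set0))) -nat1r.
    rewrite -nat1r in nS0.
    by field; rewrite n0 nS0 A0.
  under eq_bigr do rewrite E.
  by rewrite sumrB -!mulr_sumr (sum_mean_spin v y false) subrr.
have [->|xT] := eqVneq x finset.setT.
  have E s : F s true finset.setT + F s false finset.setT
    = n.+1%:R^-1 * ((block (s, (true, finset.setT)) == y)%:R * mean_spin v s true)
      - n.+1%:R^-1 * ((block (s, (true, finset.setT)) == y)%:R * spin v s None).
    rewrite /F /weight /score /agreement /ones /= cardsT card_ord add1n add0n eqxx.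
    have -> : (n == n.+1)%N = false by lia.
    have -> : (n == 0)%N = false by lia.
    rewrite column_weightn /column_weight eqxx orbT.
    rewrite -[block (s, (false, _))]/(block (s, (true, finset.setT))) -nat1r.
    rewrite -nat1r in nS0.
    by field; rewrite n0 nS0 A0.
  under eq_bigr do rewrite E.
  by rewrite sumrB -!mulr_sumr (sum_mean_spin v y true) subrr.
(* For a mixed visible column the agreement vanishes and the scores cancel for each permutation
   separately. *)
apply: big1 => s _.
have hw : (0 < #|x| < n)%N.
  rewrite card_gt0 x0 /= ltn_neqAle.
  have := subset_leq_card (finset.subsetT x); rewrite cardsT card_ord => ->; rewrite andbT.
  by apply: contra xT => /eqP hx; rewrite eqEcard finset.subsetT cardsT card_ord hx leqnn.
have hrec := column_weight_step hw.
rewrite /F /weight /score /agreement /ones /= add1n add0n.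
have -> : (#|x|.+1 == n.+1)%N = false by lia.
have -> : (#|x| == n.+1)%N = false by lia.
have -> : (#|x| == 0)%N = false by lia.
rewrite -[block (s, (true, _))]/(block (s, (false, x))) /= !mulr0 !addr0 -mulrDr.
rewrite natrB in hrec; last lia.
have -> : column_weight #|x|.+1 * (spin v s None * (1 - #|x|.+1%:R / n.+1%:R))
  + column_weight #|x| * (spin v s None * (0 - #|x|%:R / n.+1%:R))
  = spin v s None / n.+1%:R * (column_weight #|x|.+1 * (n%:R - #|x|%:R) - column_weight #|x| * #|x|%:R).
  by rewrite -[#|x|.+1%:R]nat1r -[n.+1%:R]nat1r; rewrite -nat1r in nS0; field.
by rewrite hrec subrr !mulr0.
Qed.

(** The [n]-th harmonic number: the term at zero vanishes since [0^-1 = 0]. *)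
Definition harmonic_sum : R := \sum_(w < n.+1) w%:R^-1.

(** This is the mass, for one permutation, of the mixed visible columns with [w] ones. Its sum over
    [w] is logarithmic in [n], so an [A] of that order suffices. *)
Lemma binomial_weight (w : nat) : (0 < w < n)%N ->
  'C(n, w)%:R * (column_weight w.+1 + column_weight w) = w%:R^-1 + (n - w)%:R^-1.
Proof.
move=> hw; have := bin_fact (m := w) (n := n); rewrite /column_weight.
have -> : (w.+1 == 0)%N || (w.+1 == n.+1)%N = false by lia.
have -> : (w == 0)%N || (w == n.+1)%N = false by lia.
have [w' ew] : exists w', w = w'.+1 by exists w.-1; lia.
rewrite ew in hw *.
have [r hr] : exists r, (n - w'.+1)%N = r.+1 by exists (n - w'.+2)%N; lia.
have -> : (n - w'.+2)%N = r by lia.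
rewrite hr !factS /= => /(_ _) <-; last lia.
rewrite !natrM.
have f0 k : k`!%:R != 0 :> R by rewrite pnatr_eq0 -lt0n fact_gt0.
have b0 : 'C(n, w'.+1)%:R != 0 :> R by rewrite pnatr_eq0 -lt0n bin_gt0; lia.
have s0 k : 1 + k%:R != 0 :> R by rewrite nat1r pnatr_eq0.
by field; rewrite !f0 b0 !s0.
Qed.

(** For each permutation the constant states have mass [2 A] and the others exactly twice the
    harmonic sum. Hence the factor 9 gives the constant states nine tenths of the mass; the
    threshold 7/10 leaves a margin of 1/5 for the Chernoff bound. *)
Lemma sum_weight_constant_state : 9 * harmonic_sum <= A ->
  \sum_(h : state n B) weight h * (7 / 10 - (constant_state h)%:R + 1 / 5) <= 0.
Proof.
move=> hA; pose G k : R := column_weight k * (7 / 10 - ((k == 0)%N || (k == n.+1)%N)%:R + 1 / 5).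
rewrite (sum_states (fun s g x => G (g + #|x|)%N)) exchange_big /=.
apply: sumr_le0 => s _.
rewrite (partition_big (fun x => inord #|x| : 'I_n.+1) predT) //=.
have E (w : 'I_n.+1) : \sum_(x : {set 'I_n} | inord #|x| == w) (G (1 + #|x|)%N + G (0 + #|x|)%N)
  = 9 / 10 * (w%:R^-1 + (n - w)%:R^-1) - A / 10 * ((w == 0 :> nat)%:R + (w == n :> nat)%:R).
  transitivity ('C(n, w)%:R * (G w.+1 + G w)).
    transitivity (\sum_(x in [set x : {set 'I_n} | #|x| == w]) (G w.+1 + G w)).
      apply: eq_big => x.
        have := subset_leq_card (finset.subsetT x); rewrite cardsT card_ord => hx.
        by rewrite inE -val_eqE /= inordK.
      have := subset_leq_card (finset.subsetT x); rewrite cardsT card_ord => hx.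
      by move=> /eqP <-; rewrite inordK.
    by rewrite sumr_const card_draws card_ord mulr_natl.
  have w_le : (w <= n)%N by rewrite -ltnS.
  (* At both ends one inverse is [0^-1 = 0]; the other, [1 / n], is the weight of the state whose
     ghost bit differs from all visible bits. *)
  have [w0|w0] := eqVneq (w : nat) 0%N.
    rewrite w0 /G bin0 column_weight1 /column_weight /= subn0 invr0.
    have -> : (1 == n.+1)%N = false by lia.
    have -> : (0 == n)%N = false by lia.
    by rewrite /=; field; rewrite pnatr_eq0 -lt0n.
  have [wn|wn] := eqVneq (w : nat) n.
    rewrite wn /G binn column_weightn /column_weight eqxx /= subnn invr0.
    have -> : (n == n.+1)%N = false by lia.
    have -> : (n == 0)%N = false by lia.
    by rewrite /=; field; rewrite pnatr_eq0 -lt0n.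
  have hw : (0 < w < n)%N by lia.
  rewrite -(binomial_weight hw) /G.
  have -> : (w.+1 == 0)%N || (w.+1 == n.+1)%N = false by lia.
  have -> : ((w : nat) == 0)%N || ((w : nat) == n.+1)%N = false by lia.
  by rewrite /=; field.
under eq_bigr do rewrite E.
rewrite sumrB -!mulr_sumr !big_split /= -/harmonic_sum.
have -> : \sum_(w < n.+1) (n - w)%:R^-1 = harmonic_sum.
  rewrite (reindex_inj rev_ord_inj) /=; apply: eq_bigr => i _.
  by congr (_%:R^-1); have := ltn_ord i; lia.
have -> : \sum_(w < n.+1) (w == 0 :> nat)%:R = 1 :> R.
  rewrite (bigD1 ord0) //= big1 ?addr0 // => i; rewrite -val_eqE /= => /negPf -> //.
have -> : \sum_(w < n.+1) (w == n :> nat)%:R = 1 :> R.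
  rewrite (bigD1 ord_max) //= eqxx big1 ?addr0 // => i; rewrite -val_eqE /= => /negPf -> //.
lra.
Qed.

End Code.

(** * Accusations *)

Section Swap.
Variables (R : realType) (n B : nat).
Implicit Types (h : state n B) (i : 'I_n) (v : {ffun slot B -> bool}).

Definition swap i h : state n B :=
  (h.1, (i \in h.2.2, if h.2.1 then i |: h.2.2 else h.2.2 :\ i)).

Lemma swapK i : involutive (swap i).
Proof.
move=> [s [g x]]; rewrite /swap /=; congr (_, (_, _)).
  by case: g; rewrite !inE eqxx.
have [ix|ix] := boolP (i \in x); case: g; apply/setP => k; rewrite !inE;
  by have [->|] //= := eqVneq k i; rewrite ?(negPf ix).
Qed.

Lemma ones_swap i h : ones (swap i h) = ones h.
Proof.
case: h => s [g x]; rewrite /swap /ones /=; case: g.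
  by rewrite cardsU1; case: (i \in x).
by rewrite [in RHS](cardsD1 i x).
Qed.

Lemma weight_swap (A : R) i h : weight A (swap i h) = weight A h.
Proof. by rewrite /weight ones_swap. Qed.

Lemma agreement_swap v i h : agreement R v (swap i h) = agreement R v h.
Proof. by rewrite /agreement ones_swap. Qed.

Lemma score_swap v i h : score R v None (swap i h) = score R v (Some i) h.
Proof. by rewrite /score ones_swap. Qed.

(** Exchanging row [i] with the ghost is visible in row [i] only, which is what lets privacy
    apply. *)
Lemma block_swap i k h j : k != i -> (k \in block (swap i h) j) = (k \in block h j).
Proof.
move=> ki; rewrite !ffunE /slot_column; case: (h.1 j) => [[]|] //=.
by case: h.2.1; rewrite !inE (negPf ki).
Qed.

End Swap.

(** * Errors of an answer on marked columns *)

Definition disagrees n (c : {set 'I_n}) (b : bool) : bool :=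
  (c == finset.setT) && ~~ b || (c == finset.set0) && b.

(** Errors of both signs are counted together and against all columns, a consequence of strong
    agreement that survives rounding. *)
Definition agrees n (C : finType) (Y : {ffun C -> {set 'I_n}}) (v : {ffun C -> bool}) : bool :=
  (10 * (\sum_c disagrees (Y c) (v c)) <= #|C|)%N.

(** Each error on one of the [B.+1] slots averaged by [mean_spin] flips a sign and costs [2 / B.+1];
    errors on the other slots only lower the left side. *)
Lemma agreement_ge (R : realType) n B (v : {ffun slot B -> bool}) (h : state n B) :
  (constant_state h)%:R - 2 / B.+1%:R * (\sum_j disagrees (block h j) (v j))%N%:R
  <= agreement R v h.
Proof.
have BS : (0 : R) < B.+1%:R by rewrite ltr0n.
have c0 : 0 <= 2 / B.+1%:R :> R by rewrite divr_ge0.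
pose D t := disagrees (slot_column h.2.2 t) (v ((h.1^-1)%g t)).
have -> : (\sum_j disagrees (block h j) (v j) = \sum_t D t)%N.
  rewrite [RHS](reindex_inj (@perm_inj _ h.1)) /=; apply: eq_bigr => j _.
  by rewrite /D permK ffunE.
have key (b : bool) : h.2.2 = (if b then finset.setT else finset.set0) ->
  1 - 2 / B.+1%:R * (\sum_t D t)%N%:R <= (if b then 1 else -1) * mean_spin R v h.1 b.
  move=> hx.
  have hD t : slot_column h.2.2 t = h.2.2 ->
      1 - 2 * (D t)%:R <= (if b then 1 else -1) * spin R v h.1 t.
    move=> ht; rewrite /D /disagrees ht hx /spin.
    by case: (b); case: (v _); rewrite eqxx ?orbT ?andbT ?andbF /=; try case: (_ == _); rewrite /=; lra.
  have hS : (D None + \sum_i D (Some (b, i)) <= \sum_t D t)%N.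
    have -> : (\sum_t D t = D None + \sum_b' \sum_i D (Some (b', i)))%N.
      by rewrite big_option pair_bigA; congr addn; apply: eq_bigr => -[].
    rewrite leq_add2l.
    by rewrite big_bool; case: (b); rewrite ?leq_addr ?leq_addl.
  rewrite mulrA ler_pdivlMr // mulrBl mul1r mulrAC divfK ?gt_eqF //.
  apply: (@le_trans _ _ (B.+1%:R - 2 * (D None + \sum_i D (Some (b, i)))%N%:R)).
    by rewrite lerD2l lerN2 ler_pM2l // ler_nat.
  rewrite mulrDr natrD natr_sum.
  have h0 := hD None erefl.
  have : \sum_(i < B) (1 - 2 * (D (Some (b, i)))%:R)
      <= \sum_(i < B) (if b then 1 else -1) * spin R v h.1 (Some (b, i)).
    by apply: ler_sum => i _; apply: hD; rewrite hx; case: (b).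
  rewrite sumrB sumr_const card_ord -!mulr_sumr -[B.+1%:R]nat1r.
  by move: h0; rewrite /=; lra.
rewrite /agreement /constant_state; have [e1|_] := eqVneq (ones h) n.+1.
  have hc : #|h.2.2| = n.
    have := subset_leq_card (finset.subsetT h.2.2); rewrite cardsT card_ord.
    by move: e1; rewrite /ones; case: h.2.1 => /=; lia.
  rewrite orbT; have := key true; rewrite mul1r; apply.
  by apply/eqP; rewrite eqEcard finset.subsetT cardsT card_ord hc leqnn.
have [e0|_] := eqVneq (ones h) 0%N.
  have := key false; rewrite mulN1r; apply.
  by apply/eqP; rewrite -cards_eq0; move: e0; rewrite /ones; lia.
by rewrite /= sub0r oppr_le0 mulr_ge0.
Qed.

(** * Fingerprinting a mechanism with finitely many answers *)

Section FiniteMechanism.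
Variables (R : realType) (n m B : nat) (L : finType) (sign : L -> bool) (A : R).
Hypotheses (n_gt0 : (0 < n)%N) (A_ge1 : 1 <= A) (A_ge : 9 * harmonic_sum R n <= A).

Local Notation column := ('I_m * slot B + L)%type.
Local Notation hidden := {ffun 'I_m -> state n B}.
Local Notation answer := {ffun column -> bool}.
Implicit Types (h : hidden) (v : answer) (o : option 'I_n).

Definition dataset (y : {ffun 'I_m -> {ffun slot B -> {set 'I_n}}}) :
    {ffun column -> {set 'I_n}} :=
  [ffun c => match c with
             | inl bj => y bj.1 bj.2
             | inr l => if sign l then finset.setT else finset.set0
             end].

Definition observed h := dataset [ffun b => block (h b)].

Definition block_answer v (b : 'I_m) : {ffun slot B -> bool} := [ffun j => v (inl (b, j))].

Definition prior h : R := \prod_b weight A (h b).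

Definition total_agreement v h : R := \sum_b agreement R (block_answer v b) (h b).

Definition total_score v o h : R := \sum_b score R (block_answer v b) o (h b).

(** The first condition is there for the ghost: only an agreeing answer drives its score below
    zero. *)
Definition accuses o h v : bool :=
  (m%:R / 5 <= total_agreement v h) && (0 <= total_score v o h).

Definition swap_all (i : 'I_n) h : hidden := [ffun b => swap i (h b)].

Let A_gt0 : 0 < A. Proof. exact: lt_le_trans A_ge1. Qed.

Let eps : R := (n.+1%:R * A)^-1.

Let eta : R := expR (- (m%:R * (eps / 5) ^+ 2 / 32)).

Lemma prior_ge0 h : 0 <= prior h.
Proof. by apply: prodr_ge0 => b _; exact: weight_ge0. Qed.

Lemma prior_swap i h : prior (swap_all i h) = prior h.
Proof. by apply: eq_bigr => b _; rewrite ffunE weight_swap. Qed.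

Lemma swap_allK i : involutive (swap_all i).
Proof. by move=> h; apply/ffunP => b; rewrite !ffunE swapK. Qed.

Lemma accuses_swap i h v : accuses None (swap_all i h) v = accuses (Some i) h v.
Proof.
rewrite /accuses /total_agreement /total_score.
under eq_bigr do rewrite ffunE agreement_swap.
by under [X in _ && (0 <= X)]eq_bigr do rewrite ffunE score_swap.
Qed.

Lemma observed_inl h (b : 'I_m) (j : slot B) : observed h (inl (b, j)) = block (h b) j.
Proof. by rewrite /observed ffunE /= ffunE. Qed.

Lemma observed_inr h (l : L) :
  observed h (inr l) = if sign l then finset.setT else finset.set0.
Proof. by rewrite ffunE. Qed.

Lemma observed_swap i k h c : k != i ->
  (k \in observed (swap_all i h) c) = (k \in observed h c).
Proof.
move=> ki; case: c => [[b j]|l]; last by rewrite !observed_inr.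
rewrite !observed_inl -[RHS](block_swap _ _ ki).
by have -> : swap_all i h b = swap i (h b) by rewrite ffunE.
Qed.

Lemma exists_accused v h : m%:R / 5 <= total_agreement v h -> exists o, accuses o h v.
Proof.
move=> hG; have [k hk] : exists o, 0 <= total_score v o h; last by exists k; apply/andP.
apply: contrapT => hno.
have : \sum_o total_score v o h < \sum_(o : option 'I_n) 0.
  apply: ltr_sum; first by apply/hasP; exists None; rewrite ?mem_index_enum.
  move=> o _; rewrite real_ltNge ?num_real //; apply/negP => ho.
  by apply: hno; exists o.
rewrite exchange_big /= big1_eq big1 ?ltxx // => b _; exact: sum_score.
Qed.

(** Every block has [B] pads of each sign, whatever its code column is. *)
Lemma card_marked_observed h (b : bool) :
  (m * B + #|[set l | sign l == b]|
   <= #|[set c | observed h c == if b then finset.setT else finset.set0]|)%N.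
Proof.
rewrite -!sum1dep_card [X in (_ <= X)%N]big_mkcond big_sumType /= big_mkcond /=.
apply: leq_add; last first.
  apply: leq_sum => l _; rewrite observed_inr.
  by case: eqP => // ->; rewrite eqxx.
have -> : (m * B = \sum_(a < m) B)%N by rewrite sum_nat_const card_ord.
apply: (@leq_trans (\sum_(a < m) \sum_j
    (block (h a) j == if b then finset.setT else finset.set0))%N).
  apply: leq_sum => a _; rewrite (reindex_inj (@perm_inj _ ((h a).1^-1)%g)) /= big_option /=.
  have -> : (\sum_i (block (h a) (((h a).1^-1)%g (Some i))
      == if b then finset.setT else finset.set0)
    = \sum_b' \sum_i (slot_column (h a).2.2 (Some (b', i) : slot B)
      == if b then finset.setT else finset.set0))%N.
    by rewrite pair_bigA; apply: eq_bigr => -[b' i] _; rewrite ffunE permKV.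
  apply: leq_trans (leq_addl _ _); rewrite (bigD1 b) //=.
  by apply: leq_trans (leq_addr _ _); rewrite eqxx sum_nat_const card_ord muln1.
rewrite pair_bigA /=; apply: leq_sum => -[a j] _ /=.
by rewrite observed_inl; case: eqP.
Qed.

Section Answers.
Variable P : {ffun column -> {set 'I_n}} -> answer -> R.
Hypotheses (P_ge0 : forall Y v, 0 <= P Y v) (P_sum1 : forall Y, \sum_v P Y v = 1).

(** Adding [eps (agreement - 1/5)] to the ghost score of each block keeps the sum nonnegative under
    an accusation, and by [conditional_mean] makes the conditional mean exactly [- eps / 5]. *)
Lemma ghost_rarely_accused :
  \sum_h prior h * \sum_(v | accuses None h v) P (observed h) v
  <= eta * \sum_h prior h.
Proof.
have eps0 : 0 < eps by rewrite invr_gt0 mulr_gt0 // ltr0n.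
have eps1 : eps <= 1 / 2.
  rewrite div1r lef_pV2 ?posrE ?mulr_gt0 ?ltr0n //.
  by rewrite -[leLHS]mulr1 ler_pM // ler_nat; lia.
pose w v (b : 'I_m) (s : state n B) : R := score R (block_answer v b) None s
  + eps * (agreement R (block_answer v b) s - 1 / 5).
have hW v h : \sum_b w v b (h b) = total_score v None h + eps * (total_agreement v h - m%:R / 5).
  rewrite /w big_split -mulr_sumr sumrB /= sumr_const card_ord -[_ *+ m]mulr_natl.
  by rewrite mulrA mulr1.
under eq_bigr do rewrite mulr_sumr.
rewrite (exchange_big_dep predT) //=.
have -> : \sum_h prior h = \sum_v \sum_h prior h * P (observed h) v.
  by rewrite exchange_big /=; apply: eq_bigr => h _; rewrite -mulr_sumr P_sum1 mulr1.
rewrite mulr_sumr; apply: ler_sum => v _.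
(* The answer [v] is fixed; its probability depends on the hidden state through the blocks only and
   serves as [Q]. *)
have := conditional_chernoff (I := 'I_m) (D := @block n B) (@weight_ge0 _ n B A A_gt0)
  (Q := fun y => P (dataset y) v) (w := w v) (c := eps / 5).
rewrite card_ord => /(_ _ _ _ _) hch.
apply: le_trans (hch _ _ _ _); last 1 first.
- move=> b y; rewrite -[X in _ <= X](conditional_mean n_gt0 A_gt0 (block_answer v b) y).
  by apply: ler_sum => s _; rewrite /w -/eps ler_wpM2l ?weight_ge0 //; lra.
- rewrite big_mkcond [X in _ <= X]big_mkcond /=; apply: ler_sum => h _.
  case: ifP => [/andP[h1 h2]|_].
    by rewrite hW ifT // addr_ge0 // mulr_ge0 ?subr_ge0 // ltW.
  by case: ifP => // _; rewrite mulr_ge0 ?prior_ge0.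
- by [].
- by apply/andP; split; lra.
- move=> b s; have := normr_score R (block_answer v b) None s.
  have := normr_agreement R (block_answer v b) s.
  rewrite !ler_norml /w => /andP[a1 a2] /andP[s1 s2].
  by apply/andP; split; nra.
Qed.

(** The same Chernoff bound with a trivial observation. *)
Lemma constant_states_frequent :
  \sum_(h : hidden | \sum_b (constant_state (h b))%:R < 7 / 10 * m%:R :> R) prior h
  <= expR (- (m%:R * (1 / 5) ^+ 2 / 32)) * \sum_h prior h.
Proof.
have := conditional_chernoff (I := 'I_m) (D := fun _ : state n B => tt)
  (@weight_ge0 _ n B A A_gt0) (Q := fun=> 1)
  (w := fun _ s => 7 / 10 - (constant_state s)%:R) (c := 1 / 5).
rewrite card_ord => hch.
have E (h : hidden) : (\prod_i weight A (h i)) * 1 = prior h by rewrite mulr1.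
under [X in _ <= _ * X]eq_bigr do rewrite -E.
apply: le_trans (hch _ _ _ _); last 1 first.
- by move=> _ []; apply: sum_weight_constant_state.
- rewrite big_mkcond [X in _ <= X]big_mkcond /=; apply: ler_sum => h _.
  rewrite E sumrB sumr_const card_ord -[7 / 10 *+ m]mulr_natr subr_ge0.
  case: ltP => [/ltW ->|_] //.
  by case: ifP => // _; exact: prior_ge0.
- by [].
- by clear hch; apply/andP; split; lra.
- by clear hch; move=> _ s; rewrite ler_norml; case: (constant_state s) => /=; apply/andP; split; lra.
Qed.

(** The errors are at most a tenth of the columns, hence at most [m B.+1 / 4]; at a price of
    [2 / B.+1] each they cost [m / 2], and [7/10 - 1/2 = 1/5]. *)
Lemma agrees_total_agreement h v : (2 * #|{: column}| <= 5 * (m * B.+1))%N ->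
  agrees (observed h) v -> 7 / 10 * m%:R <= \sum_b (constant_state (h b))%:R :> R ->
  m%:R / 5 <= total_agreement v h.
Proof.
move=> hC hA hK.
have BS : (0 : R) < B.+1%:R by rewrite ltr0n.
pose dis b := (\sum_j disagrees (block (h b) j) (block_answer v b j))%N.
have hd : (4 * \sum_b dis b <= m * B.+1)%N.
  have : (\sum_b dis b <= \sum_c disagrees (observed h c) (v c))%N.
    rewrite big_sumType /= -[X in (X <= _)%N]addn0 leq_add //.
    rewrite /dis pair_bigA /=; apply: leq_sum => -[b j] _ /=.
    by rewrite observed_inl [block_answer v b j]ffunE.
  have : (10 * (\sum_c disagrees (observed h c) (v c)) <= #|{: column}|)%N by [].
  by move: hC; lia.
have hs : \sum_b (constant_state (h b))%:R - 2 / B.+1%:R * (\sum_b dis b)%N%:R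
    <= total_agreement v h.
  rewrite natr_sum mulr_sumr -sumrB; apply: ler_sum => b _; exact: agreement_ge.
apply: le_trans hs.
have : 2 / B.+1%:R * (\sum_b dis b)%N%:R <= m%:R / 2 :> R.
  rewrite mulrAC ler_pdivrMr //.
  by rewrite mulrAC -natrM; move: hd; rewrite -(ler_nat R) [(4 * _)%:R]natrM; lra.
by move: (2 / _ * _) => z hz; lra.
Qed.

Lemma sum_prior_gt0 : 0 < \sum_h prior h.
Proof.
pose h0 : hidden := [ffun=> (1%g, (false, finset.set0))].
rewrite (bigD1 h0) //= ltr_wpDr ?sumr_ge0 // => [h _|]; first exact: prior_ge0.
by apply: prodr_gt0 => b _; rewrite ffunE /weight /ones cards0.
Qed.

Lemma finite_mechanism_bound (beta delta : R) :
  (2 * #|{: column}| <= 5 * (m * B.+1))%N ->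
  (forall i (Y Y' : {ffun column -> {set 'I_n}}) (T : pred answer),
     (forall c k, k != i -> (k \in Y c) = (k \in Y' c)) ->
     \sum_(v | T v) P Y v <= expR 1 * \sum_(v | T v) P Y' v + delta) ->
  (forall h, beta <= \sum_(v | agrees (observed h) v) P (observed h) v) ->
  beta <= expR (- (m%:R * (1 / 5) ^+ 2 / 32)) + eta + n%:R * (expR 1 * eta + delta).
Proof.
move=> hC hdp hacc.
pose bad (h : hidden) := \sum_b (constant_state (h b))%:R < 7 / 10 * m%:R :> R.
have Z0 := sum_prior_gt0.
rewrite -(ler_pM2r Z0).
(* Privacy replaces the dataset by the one with row [i] and the ghost exchanged; there the
   accusation of row [i] is one of the ghost, and the prior is invariant under the exchange. *)
have hrow i : \sum_h prior h * \sum_(v | accuses (Some i) h v) P (observed h) v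
    <= (expR 1 * eta + delta) * \sum_h prior h.
  apply: (@le_trans _ _ (\sum_h prior h * (expR 1 *
      (\sum_(v | accuses None (swap_all i h) v) P (observed (swap_all i h)) v) + delta))).
    apply: ler_sum => h _; apply: ler_wpM2l; first exact: prior_ge0.
    under eq_bigl do rewrite -accuses_swap.
    by apply: (hdp i) => c k ki; rewrite observed_swap.
  under eq_bigr do rewrite mulrDr mulrCA -(prior_swap i).
  rewrite big_split /= -mulr_sumr -mulr_suml mulrDl.
  rewrite -(reindex_inj (can_inj (swap_allK i)) (F := fun h => prior h *
    \sum_(v | accuses None h v) P (observed h) v) (P := predT)) /=.
  under [X in _ + X * _ <= _]eq_bigr do rewrite prior_swap.
  rewrite [_ * delta]mulrC lerD2r -mulrA ler_pM2l ?expR_gt0 //.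
  exact: ghost_rarely_accused.
(* Union bound: unless too few states are constant, every agreeing answer accuses a row or the
   ghost. *)
apply: (@le_trans _ _ (\sum_h prior h * ((bad h)%:R +
   \sum_o \sum_(v | accuses o h v) P (observed h) v))).
  rewrite mulr_sumr; apply: ler_sum => h _; rewrite mulrC ler_wpM2l ?prior_ge0 //.
  apply: (le_trans (hacc h)).
  have sum_ge0 o : 0 <= \sum_(v | accuses o h v) P (observed h) v by apply: sumr_ge0.
  case: (boolP (bad h)) => hb /=.
    apply: (@le_trans _ _ 1); last by rewrite lerDl sumr_ge0.
    rewrite -(P_sum1 (observed h)) big_mkcond /=; apply: ler_sum => v _.
    by case: ifP.
  rewrite add0r (exchange_big_dep predT) //= big_mkcond /=; apply: ler_sum => v _.
  case: ifP => [hv|_]; last exact: sumr_ge0.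
  have [k hk] : exists o, accuses o h v.
    by apply: exists_accused; apply: agrees_total_agreement; rewrite // leNgt.
  by rewrite (bigD1 k) //= lerDl sumr_ge0.
under eq_bigr do rewrite mulrDr.
rewrite big_split /= -addrA mulrDl; apply: lerD.
  apply: le_trans constant_states_frequent.
  rewrite [X in _ <= X]big_mkcond; apply: ler_sum => h _.
  by rewrite -/(bad h); case: (bad h); rewrite ?mulr1 ?mulr0.
under eq_bigr do rewrite mulr_sumr.
rewrite exchange_big big_option /= mulrDl; apply: lerD; first exact: ghost_rarely_accused.
apply: le_trans (ler_sum _ (fun i _ => hrow i)) _.
by rewrite sumr_const card_ord -mulrA mulr_natl.
Qed.

End Answers.

End FiniteMechanism.

(** * Discretizing a mechanism *)

Local Open Scope classical_set_scope.

Lemma measure_finite_fibers (disp : measure_display) (R : realType)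
    (T : measurableType disp) (mu : {measure set T -> \bar R}) (V : finType)
    (F : T -> V) (S : pred V) :
  (forall v, measurable [set q | F q = v]) ->
  mu [set q | S (F q)] = (\sum_(v | S v) mu [set q | F q = v])%E.
Proof.
move=> mF.
have -> : [set q | S (F q)] = \bigcup_(v in [set` enum S]) [set q | F q = v].
  apply/seteqP; split => [q /= Sq|q [v /=]]; first by exists (F q); rewrite //= mem_enum.
  by rewrite mem_enum => Sv ->.
rewrite measure_fin_bigcup //; last first.
  by apply/trivIsetP => u v _ _ /eqP uv; apply/seteqP; split => // q [/= -> /uv].
by rewrite -fsbig_seq ?enum_uniq // big_enum.
Qed.

Section Rounding.
Variables (R : realType) (d : nat).

(** Both comparisons are kept because an entry may be neither 1 nor -1. Strong agreement and
    rounding factor through this finite type, which gives their measurability. *)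
Definition pattern (q : d.-tuple R) : {ffun 'I_d -> bool * bool} :=
  [ffun j => (tnth q j == 1, tnth q j == -1)].

Lemma measurable_tnth_eq (j : 'I_d) (a : R) (b : bool) :
  measurable [set q : d.-tuple R | (tnth q j == a) = b].
Proof.
have m1 : measurable [set q : d.-tuple R | tnth q j = a].
  by rewrite -[X in measurable X]setTI; apply: (measurable_tnth j measurableT (measurable_set1 a)).
case: b.
  by rewrite (_ : [set _ | _] = [set q : d.-tuple R | tnth q j = a]) //;
    apply/seteqP; split => q /= /eqP.
rewrite (_ : [set _ | _] = ~` [set q : d.-tuple R | tnth q j = a]); first exact: measurableC.
by apply/seteqP; split => q /= => [/negbT/eqP|h] //; apply/eqP.
Qed.

Lemma measurable_pattern (S : {ffun 'I_d -> bool * bool} -> Prop) :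
  measurable [set q | S (pattern q)].
Proof.
have -> : [set q | S (pattern q)] = \bigcup_(p in [set p | S p]) [set q | pattern q = p].
  by apply/seteqP; split => [q /= Sq|q [v /= Sv ->]] //; exists (pattern q).
apply: fin_bigcup_measurable; first exact: finite_finset.
move=> p _.
have -> : [set q | pattern q = p] = \bigcap_(j in [set: 'I_d])
    ([set q | (tnth q j == 1) = (p j).1] `&` [set q | (tnth q j == -1) = (p j).2]).
  apply/seteqP; split => [q /= <- j _|q /= hq]; first by rewrite /= !ffunE.
  by apply/ffunP => j; rewrite ffunE; have [/= -> ->] := hq j I; case: (p j).
apply: fin_bigcap_measurable; first exact: finite_finset.
by move=> j _; apply: measurableI; apply: measurable_tnth_eq.
Qed.

End Rounding.

Section Discretization.
Variables (R : realType) (n d : nat) (C : finType) (f : C -> 'I_d) (g : 'I_d -> C).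
Hypotheses (n_gt0 : (0 < n)%N) (fK : cancel f g) (gK : cancel g f).

Definition encode (Y : {ffun C -> {set 'I_n}}) : 'M[R]_(n, d) :=
  \matrix_(i, j) (if i \in Y (g j) then 1 else -1).

Definition rounded (q : d.-tuple R) : {ffun C -> bool} := [ffun c => tnth q (f c) == 1].

Lemma measurable_rounded (S : {ffun C -> bool} -> Prop) : measurable [set q | S (rounded q)].
Proof.
pose S' (p : {ffun 'I_d -> bool * bool}) := S [ffun c => (p (f c)).1].
have -> : [set q | S (rounded q)] = [set q | S' (pattern q)].
  apply/seteqP; split => q /=; rewrite /S' (_ : [ffun c => _] = rounded q) //;
    by apply/ffunP => c; rewrite !ffunE.
exact: measurable_pattern.
Qed.

Lemma measurable_strongly_agrees (X : 'M[R]_(n, d)) : measurable [set q | strongly_agrees X q].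
Proof.
pose S (p : {ffun 'I_d -> bool * bool}) : Prop :=
    #|[set j in marked X 1 | (p j).1]|%:R >= (9 / 10) * #|marked X 1|%:R :> R /\
    #|[set j in marked X (-1) | (p j).2]|%:R >= (9 / 10) * #|marked X (-1)|%:R :> R.
have -> : [set q | strongly_agrees X q] = [set q | S (pattern q)].
  have E1 q : [set j in marked X 1 | (pattern q j).1] = [set j in marked X 1 | tnth q j == 1].
    by apply/setP => j; rewrite !inE ffunE.
  have E2 q : [set j in marked X (-1) | (pattern q j).2]
      = [set j in marked X (-1) | tnth q j == -1].
    by apply/setP => j; rewrite !inE ffunE.
  apply/seteqP; split => q /=; rewrite /S E1 E2.
    by move=> h; split; apply: h; [left|right].
  by move=> [h1 h2] b [->|->].
exact: measurable_pattern.
Qed.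

Lemma pm1_encode Y : pm1_dataset (encode Y).
Proof. by move=> i j; rewrite mxE; case: ifP; [left|right]. Qed.

Let N1 : (1 : R) != -1.
Proof. by apply/eqP => h; lra. Qed.

Lemma marked_encode Y (b : bool) : marked (encode Y) (if b then 1 else -1)
  = [set j | Y (g j) == if b then finset.setT else finset.set0]%SET.
Proof.
apply/setP => j; rewrite !inE; apply/forallP/eqP => [h|h i].
  apply/setP => i; have := h i; rewrite mxE.
  by case: b {h}; rewrite !inE; case: (i \in _); rewrite // ?(negPf N1) // eq_sym (negPf N1).
by rewrite mxE h; case: b {h}; rewrite !inE.
Qed.

Lemma strongly_agrees_rounded Y q : strongly_agrees (encode Y) q -> agrees Y (rounded q).
Proof.
move=> hq; pose mk (b : bool) : {set 'I_d} :=
  [set j | Y (g j) == if b then finset.setT else finset.set0]%SET.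
pose err (b : bool) : {set 'I_d} := mk b :\: [set j in mk b | tnth q j == if b then 1 else -1].
have herr b : (10 * #|err b| <= #|mk b|)%N.
  have hb : (if b then 1 else -1 : R) = 1 \/ (if b then 1 else -1 : R) = -1.
    by case: b; [left|right].
  have := hq _ hb; rewrite marked_encode -/(mk b).
  rewrite -(cardsID [set j in mk b | tnth q j == if b then 1 else -1] (mk b)) -/(err b).
  rewrite (finset.setIidPr _); last by apply/fintype.subsetP => j; rewrite inE => /andP[].
  by rewrite natrD => h; rewrite -(ler_nat R) natrM natrD; lra.
have hd : (\sum_c disagrees (Y c) (rounded q c) <= #|err true| + #|err false|)%N.
  rewrite (reindex g (onW_bij _ (Bijective gK fK))) /= -!sum1_card.
  rewrite [X in (_ <= X + _)%N]big_mkcond [X in (_ <= _ + X)%N]big_mkcond -big_split /=.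
  apply: leq_sum => j _; rewrite /disagrees ffunE gK !inE.
  have : tnth q j == 1 -> (tnth q j == -1) = false by move/eqP ->; exact/negbTE.
  case: (Y (g j) == finset.setT); case: (Y (g j) == finset.set0);
  by case: (tnth q j == 1); case: (tnth q j == -1) => // /(_ isT).
(* As there is at least one row, no column is marked with both signs. *)
have hm : (#|mk true| + #|mk false| <= #|C|)%N.
  have -> : #|C| = d.
    by rewrite -[RHS]card_ord; apply: bij_eq_card; exists g.
  rewrite -cardsUI (_ : mk true :&: mk false = finset.set0) ?cards0 ?addn0.
    by rewrite -[X in (_ <= X)%N]card_ord max_card.
  apply/setP => j; rewrite !inE; apply/negP => /andP[/eqP -> /eqP].
  by move/setP/(_ (Ordinal n_gt0)); rewrite !inE.
by rewrite /agrees; move: (herr true) (herr false); lia.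
Qed.

(** Equality is a separate case because [neighbors] requires row [i] to change. *)
Lemma neighbors_encode i (Y Y' : {ffun C -> {set 'I_n}}) :
  (forall c k, k != i -> (k \in Y c) = (k \in Y' c)) ->
  encode Y = encode Y' \/ neighbors (encode Y) (encode Y').
Proof.
move=> h; have hk k : k != i -> row k (encode Y) = row k (encode Y').
  by move=> ki; apply/rowP => j; rewrite !mxE h.
have [e|e] := eqVneq (row i (encode Y)) (row i (encode Y')); last by right; exists i.
by left; apply/row_matrixP => k; have [->|/hk] := eqVneq k i.
Qed.

Variable M : mechanism R n d.

Definition rounded_law Y v : R := fine (M (encode Y) [set q | rounded q = v]).

Lemma rounded_law_ge0 Y v : 0 <= rounded_law Y v.
Proof. by rewrite fine_ge0. Qed.

Lemma sum_rounded_law Y (S : pred {ffun C -> bool}) :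
  (\sum_(v | S v) rounded_law Y v)%:E = M (encode Y) [set q | S (rounded q)].
Proof.
have mF v : measurable [set q | rounded q = v] := measurable_rounded (fun u => u = v).
rewrite EFin_sum_fine; first by rewrite measure_finite_fibers.
by move=> v _; apply: fin_num_measure; exact: mF.
Qed.

Lemma sum_rounded_law1 Y : \sum_v rounded_law Y v = 1.
Proof.
apply: EFin_inj; rewrite (sum_rounded_law Y predT) (_ : [set q | _] = setT) ?probability_setT //.
by apply/seteqP.
Qed.

Lemma rounded_law_private delta i (Y Y' : {ffun C -> {set 'I_n}}) (S : pred {ffun C -> bool}) :
  0 <= delta -> differentially_private M 1 delta ->
  (forall c k, k != i -> (k \in Y c) = (k \in Y' c)) ->
  \sum_(v | S v) rounded_law Y v <= expR 1 * (\sum_(v | S v) rounded_law Y' v) + delta.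
Proof.
move=> d0 dp hY; have s0 : 0 <= \sum_(v | S v) rounded_law Y' v.
  by apply: sumr_ge0 => v _; exact: rounded_law_ge0.
have [e|e] := neighbors_encode hY.
  have -> : \sum_(v | S v) rounded_law Y v = \sum_(v | S v) rounded_law Y' v.
    by rewrite /rounded_law e.
  by have : 1 + 1 <= expR 1 :> R; [exact: expR_ge1Dx|nra].
rewrite -lee_fin EFinD EFinM !sum_rounded_law.
by apply: dp => //; [exact: pm1_encode|exact: pm1_encode|exact: (measurable_rounded (fun u => S u))].
Qed.

Lemma rounded_law_accurate alpha beta (Y : {ffun C -> {set 'I_n}}) :
  weakly_accurate M alpha beta ->
  (forall b : bool, (1 - alpha) * d%:R / 2
     <= #|[set c | Y c == if b then finset.setT else finset.set0]%SET|%:R) ->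
  beta <= \sum_(v | agrees Y v) rounded_law Y v.
Proof.
move=> acc hY; rewrite -lee_fin sum_rounded_law.
have hc b : #|marked (encode Y) (if b then 1 else -1)|
    = #|[set c | Y c == if b then finset.setT else finset.set0]%SET|.
  rewrite marked_encode -!sum1dep_card [RHS](reindex g (onW_bij _ (Bijective gK fK))) /=.
  by [].
apply: le_trans (acc (encode Y) (@pm1_encode Y) _ _) _.
- by have := hY true; rewrite -(hc true).
- by have := hY false; rewrite -(hc false).
apply: le_measure; rewrite ?inE.
- exact: measurable_strongly_agrees.
- exact: (measurable_rounded (fun u => agrees Y u)).
- by move=> q /=; exact: strongly_agrees_rounded.
Qed.

End Discretization.
Close Scope classical_set_scope.

(** * Choice of the parameters *)

Lemma harmonic_sum_ge1 (R : realType) n : (0 < n)%N -> 1 <= harmonic_sum R n.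
Proof.
case: n => // n _; rewrite /harmonic_sum !big_ord_recl /= invr0 add0r invr1 lerDl.
by apply: sumr_ge0 => i _; rewrite invr_ge0.
Qed.

(** By induction: [1 / (n + 2)] is at most [- ln (1 - 1 / (n + 2)) = ln (n + 2) - ln (n + 1)]. *)
Lemma harmonic_sum_le (R : realType) n : (0 < n)%N -> harmonic_sum R n <= 1 + ln n%:R.
Proof.
elim: n => // -[_ _|n IH _].
  by rewrite /harmonic_sum !big_ord_recl big_ord0 /= invr0 invr1 ln1; lra.
have := IH isT; rewrite /harmonic_sum [X in _ -> X <= _]big_ord_recr /= => h.
have p1 : (0 : R) < n.+1%:R by rewrite ltr0n.
have p2 : (0 : R) < n.+2%:R by rewrite ltr0n.
have e : n.+1%:R = n.+2%:R * (1 + - n.+2%:R^-1) :> R.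
  by rewrite mulrDr mulr1 mulrN mulfV ?gt_eqF // -[n.+2%:R]natr1 addrK.
have i1 : - 1 < - n.+2%:R^-1 :> R by rewrite ltrN2 invf_lt1 // ltr1n.
have l1 := le_ln1Dx i1.
have l2 : ln n.+1%:R = ln n.+2%:R + ln (1 + - n.+2%:R^-1) :> R.
  by rewrite [in LHS]e lnM ?posrE //; move: (_^-1) i1 => z; lra.
by move: (_^-1) l1 l2 h => z; lra.
Qed.

Lemma private_accurate_bound (R : realType) (alpha beta delta : R) (n d m B : nat)
    (M : mechanism R n d) :
  (0 < n)%N -> (m * B.*2.+1 <= d)%N -> (2 * d <= 5 * (m * B.+1))%N ->
  m.+1%:R <= alpha * d%:R -> 0 <= delta ->
  weakly_accurate M alpha beta -> differentially_private M 1 delta ->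
  beta <= expR (- (m%:R * (1 / 5) ^+ 2 / 32))
    + expR (- (m%:R * ((n.+1%:R * (9 * harmonic_sum R n))^-1 / 5) ^+ 2 / 32))
    + n%:R * (expR 1 * expR (- (m%:R * ((n.+1%:R * (9 * harmonic_sum R n))^-1 / 5) ^+ 2 / 32))
              + delta).
Proof.
move=> n0 md dm ma d0 acc dp.
(* The columns left over by the blocks are constant, half of each sign up to parity. *)
pose l := (d - m * B.*2.+1)%N.
pose L : finType := ('I_(l./2) + 'I_(l - l./2))%type.
pose sign (x : L) := if x is inl _ then true else false.
pose C : finType := ('I_m * slot B + L)%type.
have eC : #|C| = d.
  rewrite card_sum card_prod card_sum card_option card_prod card_bool !card_ord.
  by rewrite /l; nia.
pose f (c : C) : 'I_d := cast_ord eC (enum_rank c).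
pose g (j : 'I_d) : C := enum_val (cast_ord (esym eC) j).
have fK : cancel f g by move=> c; rewrite /f /g cast_ordK enum_rankK.
have gK : cancel g f by move=> j; rewrite /f /g enum_valK cast_ordKV.
have H1 := harmonic_sum_ge1 R n0.
apply: (@finite_mechanism_bound R n m B L sign (9 * harmonic_sum R n) n0 _ _
  (rounded_law f g M)).
- by lra.
- exact: lexx.
- by move=> Y v; exact: rounded_law_ge0.
- by move=> Y; exact: sum_rounded_law1.
- by have -> : #|{: 'I_m * slot B + L}| = d := eC.
- by move=> i Y Y' T hY; apply: rounded_law_private hY.
move=> h; apply: (rounded_law_accurate n0 fK gK acc) => b.
have hb := card_marked_observed sign h b.
have hl : (l./2 <= #|[set x | sign x == b]|)%N.
  rewrite -sum1dep_card big_mkcond big_sumType /=.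
  case: b {hb} => /=; rewrite !sum_nat_const !card_ord !muln1 ?muln0.
    by rewrite leq_addr.
  by lia.
(* Only the [m] code columns and one column of parity may be missing, hence the hypothesis on
   [m.+1]. *)
have : (d <= 2 * #|[set c | observed sign h c == if b then finset.setT else finset.set0]| + m.+1)%N.
  by move: hb hl; rewrite /l; nia.
rewrite -(ler_nat R) natrD natrM => hd.
by move: hd ma; lra.
Qed.

(** Without rows every column is marked with both signs, and no answer equals both on nine tenths of
    the columns. *)
Lemma weakly_accurate_n_gt0 (R : realType) (alpha beta : R) (n d : nat)
    (M : mechanism R n d) :
  0 < alpha -> 0 < beta -> (0 < d)%N -> weakly_accurate M alpha beta -> (0 < n)%N.
Proof.
case: n M => // M a0 b0 d0 acc.
have mk b : marked (0 : 'M[R]_(0, d)) b = finset.setT.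
  by apply/setP => j; rewrite !inE; apply/forallP => -[].
have dR : (0 : R) < d%:R by rewrite ltr0n.
have hc : (1 - alpha) * d%:R / 2 <= d%:R by nra.
have pm0 : pm1_dataset (0 : 'M[R]_(0, d)) by case.
have := acc _ pm0; rewrite !mk cardsT card_ord => /(_ hc hc) hM.
have e : [set q : d.-tuple R | strongly_agrees (0 : 'M[R]_(0, d)) q]%classic = classical_sets.set0.
  apply/seteqP; split => q //= hq.
  have h1 := hq 1 (or_introl erefl); have h2 := hq (-1) (or_intror erefl).
  move: h1 h2; rewrite !mk cardsT card_ord.
  set S1 := [set j in _ | _]; set S2 := [set j in _ | _].
  have hS : (#|S1| + #|S2| <= d)%N.
    rewrite -cardsUI (_ : S1 :&: S2 = finset.set0) ?cards0 ?addn0.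
      by rewrite -[X in (_ <= X)%N]card_ord max_card.
    apply/setP => j; rewrite !inE /=; apply/negP => /andP[/eqP -> /eqP h]; lra.
  by move: hS; rewrite -(ler_nat R) natrD; lra.
by move: hM; rewrite e measure0 lee_fin leNgt b0.
Qed.

(** With [B] maximal, [d] is at most [(2 B + 3) m], and [2 (2 B + 3) <= 5 (B + 1)] as soon as [B] is
    positive, that is, from [3 m <= d] on. *)
Lemma block_sizes (d m : nat) : (0 < m)%N -> (3 * m <= d)%N ->
  exists B, (m * B.*2.+1 <= d)%N /\ (2 * d <= 5 * (m * B.+1))%N.
Proof.
move=> m0 md; exists ((d %/ m).-1./2).
have k3 : (3 <= d %/ m)%N by rewrite leq_divRL.
have h1 := leq_trunc_div d m; have h2 := ltn_ceil d m0.
set B := (d %/ m).-1./2.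
have B1 : (B.*2.+1 <= d %/ m)%N by rewrite /B; lia.
have B2 : (d %/ m <= B.*2.+2)%N by rewrite /B; lia.
have B3 : (0 < B)%N by rewrite /B; lia.
split; first by rewrite mulnC (leq_trans _ h1) // leq_mul2r B1 orbT.
have : (d <= B.*2.+3 * m)%N by rewrite (leq_trans (ltnW h2)) // leq_mul2r ltnS B2 orbT.
have : (m <= B * m)%N by rewrite leq_pmull.
by move: B {B1 B2 B3} => B; nia.
Qed.

(** Were [alpha d] larger, both exponentials of [private_accurate_bound] would be at most
    [expR (- L) <= beta / (alpha d)]. Even multiplied by [n] this is a tiny part of [beta], and
    [n delta] is [beta / 4], so the bound would fail. *)
Lemma private_accurate_dimension_le (R : realType) (alpha beta : R) (n d : nat)
    (M : mechanism R n d) (L : R) :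
  (0 < n)%N -> 0 < alpha <= 1 -> 0 < beta <= 1 ->
  weakly_accurate M alpha beta ->
  differentially_private M 1 (beta / (4 * n%:R)) ->
  1 <= L -> ln (alpha * d%:R / beta) <= L ->
  alpha * d%:R <= 50 * 50 * 50 * 50 * (n%:R ^+ 2 * L ^+ 3).
Proof.
move=> n0 /andP[a0 a1] /andP[b0 b1] acc dp L1 hL.
rewrite leNgt; apply/negP => hD.
set D := alpha * d%:R in hL hD.
have n1 : 1 <= n%:R :> R by rewrite ler1n.
have n2 : n%:R <= n%:R ^+ 2 :> R by rewrite expr2; nra.
have L2 : L <= L ^+ 2 by rewrite expr2; nra.
have L3 : L ^+ 2 <= L ^+ 3 by rewrite exprS; nra.
have hnL : n%:R * L <= n%:R ^+ 2 * L ^+ 3 by apply: ler_pM; lra.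
have Dbig : 50 * 50 * 50 * 50 * (n%:R * L) < D by lra.
have DL : 50 * 50 * 50 * 50 * L < D by nra.
have Dn : 50 * 50 * 50 * 50 * n%:R < D by nra.
have D0 : 0 < D by lra.
pose m := Num.truncn (D / 3).
have /andP[m1 m2] : m%:R <= D / 3 < m.+1%:R by apply: truncn_itv; lra.
rewrite -[m.+1%:R]natr1 in m2.
have Dd : D <= d%:R by rewrite /D ler_piMl.
have m_gt0 : (0 < m)%N by rewrite -(ltr_nat R); lra.
have md : (3 * m <= d)%N by rewrite -(ler_nat R) natrM; lra.
have [B [hB1 hB2]] := block_sizes m_gt0 md.
have d0 : 0 <= beta / (4 * n%:R) by rewrite divr_ge0 ?mulr_ge0 // ltW.
have ma : m.+1%:R <= D by rewrite -natr1; lra.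
have H1 := harmonic_sum_ge1 R n0.
(* Since [n <= D / beta], the term [ln n] is absorbed by [L]. *)
have H2 : harmonic_sum R n <= 2 * L.
  apply: (le_trans (harmonic_sum_le R n0)).
  suff : ln n%:R <= ln (D / beta) by lra.
  rewrite ler_ln ?posrE ?divr_gt0 ?ltr0n // ler_pdivlMr //.
  by nra.
have E0 : expR (- L) <= beta / D.
  have -> : beta / D = expR (- ln (D / beta)) by rewrite expRN lnK ?posrE ?divr_gt0 // invf_div.
  by rewrite ler_expR lerN2.
have E1 : expR (- (m%:R * (1 / 5) ^+ 2 / 32)) <= expR (- L).
  by rewrite ler_expR lerN2 expr2; lra.
(* The constant suffices because [3 * 800 * 36^2] is about half of [50^4], where [800 = 25 * 32]. *)
have E2 : expR (- (m%:R * ((n.+1%:R * (9 * harmonic_sum R n))^-1 / 5) ^+ 2 / 32)) <= expR (- L).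
  rewrite ler_expR lerN2.
  set z := n.+1%:R * (9 * harmonic_sum R n).
  have z0 : 0 < z by rewrite mulr_gt0 ?ltr0n //; lra.
  have z1 : z <= 36 * (n%:R * L).
    have n1' : n.+1%:R <= 2 * n%:R :> R by rewrite -natr1; lra.
    have -> : 36 * (n%:R * L) = (2 * n%:R) * (9 * (2 * L)) by ring.
    by apply: ler_pM; rewrite ?mulr_ge0 //; lra.
  have z2 : z ^+ 2 <= 36 * 36 * (n%:R ^+ 2 * L ^+ 2).
    have -> : 36 * 36 * (n%:R ^+ 2 * L ^+ 2) = (36 * (n%:R * L)) ^+ 2 by ring.
    by rewrite ler_pXn2r // nnegrE; lra.
  have -> : m%:R * (z^-1 / 5) ^+ 2 / 32 = (m%:R / 800) / z ^+ 2 by field; rewrite gt_eqF.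
  rewrite ler_pdivlMr ?exprn_gt0 //.
  have z3 : L * z ^+ 2 <= 36 * 36 * (n%:R ^+ 2 * L ^+ 3).
    have -> : 36 * 36 * (n%:R ^+ 2 * L ^+ 3) = L * (36 * 36 * (n%:R ^+ 2 * L ^+ 2)) by ring.
    by apply: ler_wpM2l => //; lra.
  by lra.
have e4 : expR 1 <= 4 :> R.
  (* The quadratic bound at 1/2 is 2, and its square is 4. *)
  have -> : 1 = 1 / 2 + 1 / 2 :> R by lra.
  have := @expR_le_quad R (1 / 2) (lexx _); have := expR_gt0 (1 / 2 : R).
  by rewrite expRD expr2; nra.
have En : n%:R * expR (- L) <= beta / (50 * 50 * 50 * 50).
  apply: (@le_trans _ _ (n%:R * (beta / D))); first by rewrite ler_wpM2l.
  by rewrite mulrA ler_pdivrMr // mulrAC ler_pdivlMr; nra.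
have hdelta : n%:R * (beta / (4 * n%:R)) = beta / 4 by field; rewrite pnatr_eq0 -lt0n.
have EL := expR_gt0 (- L).
move: E1 E2; set x := expR (- (m%:R * (1 / 5) ^+ 2 / 32)); set y := expR (- (_ * (_ / 5) ^+ 2 / 32)).
move=> E1 E2; have y0 : 0 < y by exact: expR_gt0.
have := private_accurate_bound n0 hB1 hB2 ma d0 acc dp.
rewrite -/x -/y mulrDr hdelta => hb.
have h1 : n%:R * (expR 1 * y) <= 4 * (n%:R * expR (- L)).
  have -> : 4 * (n%:R * expR (- L)) = n%:R * (4 * expR (- L)) by ring.
  by apply: ler_wpM2l => //; apply: ler_pM => //; exact: ltW.
have h2 : expR (- L) <= n%:R * expR (- L) by nra.
by lra.
Qed.

(** The logarithm is cut off at one, since it may be small or negative when [alpha d / beta] is. *)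
Theorem theorem1p4 :
  exists c : rat, 0 < c /\
  forall (R : realType) (alpha beta : R) (n d : nat) (M : mechanism R n d),
    0 < alpha <= 1 -> 0 < beta <= 1 ->
    cube_valued M ->
    weakly_accurate M alpha beta ->
    differentially_private M 1 (beta / (4 * n%:R)) ->
    n%:R >= ratr c * Num.sqrt (alpha * d%:R)
              / (Num.max 1 (ln (alpha * d%:R / beta))) `^ (3 / 2).
Proof.
(* The inverse square root of the constant [50^4] in [private_accurate_dimension_le]. *)
exists ((50 * 50)^-1); split; first by rewrite invr_gt0 mulr_gt0.
move=> R alpha beta n d M ha hb _ acc dp; rewrite fmorphV rmorphM /= ratr_nat.
have [a0 a1] := andP ha; have [b0 b1] := andP hb.
have [->|d0] := posnP d; first by rewrite mulr0 sqrtr0 mulr0 mul0r.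
have n0 := weakly_accurate_n_gt0 a0 b0 d0 acc.
set L := Num.max _ _.
have L1 : 1 <= L by rewrite le_max lexx.
have hL : ln (alpha * d%:R / beta) <= L by rewrite le_max lexx orbT.
have L0 : 0 < L by exact: lt_le_trans L1.
have hD := private_accurate_dimension_le n0 ha hb acc dp L1 hL.
rewrite ler_pdivrMr ?powR_gt0 // ler_pdivrMl // mulrA.
have P0 : 0 <= 50 * 50 * n%:R * L `^ (3 / 2) by rewrite !mulr_ge0 // powR_ge0.
rewrite -(ger0_norm P0) -sqrtr_sqr ler_wsqrtr // (le_trans hD) //.
have P2 : (L `^ (3 / 2)) ^+ 2 = L ^+ 3.
  rewrite -powR_mulrn ?powR_ge0 // -powRrM -[RHS]powR_mulrn ?(ltW L0) //.
  by congr (_ `^ _); field.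
by rewrite [leRHS]exprMn P2 le_eqVlt; apply/orP; left; apply/eqP; ring.
Qed.
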